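(* Let $p_1, p_2, q$ be real numbers with $1\le p_1\le q<\infty$ and $1\le p_2\le q<\infty$. If $\ell^{p_2}_q\subseteq \ell^{p_1}_q$, then $p_1\le p_2$.
   Context: For $m\in\mathbb{Z}$ and $N\in\mathbb{N}_0=\mathbb{N}\cup\{0\}$ let $S_{m,N}:=\{m-N,\ldots,m,\ldots,m+N\}\subset\mathbb{Z}$, so $|S_{m,N}|=2N+1$. For $1\le p\le q<\infty$, the discrete Morrey space $\ell^p_q=\ell^p_q(\mathbb{Z})$ is the set of all scalar sequences $x=(x_j)_{j\in\mathbb{Z}}$ such that $$\|x\|_{\ell^p_q}:=\sup_{m\in\mathbb{Z},\,N\in\mathbb{N}_0}|S_{m,N}|^{\frac1q-\frac1p}\Big(\sum_{j\in S_{m,N}}|x_j|^p\Big)^{\frac1p}<\infty.$$ *)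

(* Defs.v *)
From mathcomp Require Import all_boot all_order all_algebra.
From mathcomp Require Import all_classical all_reals all_analysis.
From mathcomp Require Import complex zify.

Set Implicit Arguments.
Unset Strict Implicit.
Unset Printing Implicit Defensive.

Import Order.TTheory GRing.Theory Num.Theory.

Local Open Scope classical_set_scope.
Local Open Scope ring_scope.

Definition window (m : int) (N : nat) : seq int :=
  [seq m - N%:Z + i%:Z | i <- iota 0 (2 * N + 1)].

Lemma mem_window m N j : (j \in window m N) = (m - N%:Z <= j <= m + N%:Z).
Proof.
apply/mapP/idP => [[k]|]; first by rewrite mem_iota => kN ->; lia.
by exists (absz (j - (m - N%:Z))%R); rewrite ?mem_iota; lia.
Qed.

Lemma window_uniq m N : uniq (window m N).
Proof. by rewrite map_inj_uniq ?iota_uniq// => i k /addrI[]. Qed.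

Lemma size_window m N : size (window m N) = (2 * N + 1)%N.
Proof. by rewrite size_map size_iota. Qed.

Section DiscreteMorrey.
Context {R : realType}.

(* The scalars enter only through their real-valued absolute value: K is R or
   the complex numbers, taken as [Rcomplex R] since the norm of the latter
   takes its values in R. *)
Definition morrey_norm (K : normedZmodType R) (p q : R) (x : int -> K) :
    \bar R :=
  ereal_sup (range (fun mN : int * nat =>
    let S := window mN.1 mN.2 in
    ((size S)%:R `^ (q^-1 - p^-1) *
      (\sum_(j <- S) `|x j| `^ p) `^ p^-1)%:E)).

Definition morrey (K : normedZmodType R) (p q : R) : set (int -> K) :=
  [set x | (morrey_norm p q x < +oo)%E].

End DiscreteMorrey.

Arguments morrey {R} K p q.

(* Main.v *)
(* The sequence taking the value 1 at [j >= 0] when the integer part of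
   [j^alpha] increases from [j] to [j+1], and 0 elsewhere, with
   [alpha = 1 - p2/q], is a counterexample when [p2 < p1].  For [alpha <= 1]
   the increments of the integer part are 0 or 1, so the sum of the p-th powers
   over a window telescopes: it is at most [2 L^alpha] on every window of
   length [L], which puts the sequence in the Morrey space for [p2], and at
   least of order [L^alpha] on windows centred at 0, whereas membership for
   [p1] forces [O(L^(1 - p1/q))], of smaller order. *)

Require Import Defs.
From mathcomp Require Import all_boot all_order all_algebra.
From mathcomp Require Import all_classical all_reals all_analysis.
From mathcomp Require Import complex.
From mathcomp Require Import zify lra.

Set Implicit Arguments.
Unset Strict Implicit.

Import Order.TTheory GRing.Theory Num.Theory.
Local Open Scope classical_set_scope.
Local Open Scope ring_scope.

Lemma sum_window_telescope (V : zmodType) (f : int -> V) m N :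
  \sum_(j <- window m N) (f (j + 1) - f j) = f (m + N%:Z + 1) - f (m - N%:Z).
Proof.
pose g i := f (m - N%:Z + i%:Z).
rewrite /window big_map -[X in iota 0 X]subn0.
rewrite (eq_bigr (fun i => g i.+1 - g i)) => [|i _]; last first.
  by rewrite /g; congr (f _ - _); lia.
by rewrite telescope_sumr// /g; congr (f _ - f _); lia.
Qed.

(** With [s = x + y > 0], each ratio [z / s] lies in [0, 1], so [a <= 1] gives [z / s <= (z / s)]^
    a[. Multiply by]s [^ a] and add the cases [z = x] and [z = y]. *)
Lemma powR_subadditive (R : realType) (a x y : R) :
  0 < a -> a <= 1 -> 0 <= x -> 0 <= y -> (x + y) `^ a <= x `^ a + y `^ a.
Proof.
move=> a0 a1 x0 y0; have [s0|sN0] := eqVneq (x + y) 0.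
  by rewrite s0 powR0 ?gt_eqF// addr_ge0 ?powR_ge0.
have s_gt0 : 0 < x + y by rewrite lt_neqAle eq_sym sN0 addr_ge0.
have scale z : 0 <= z -> z <= x + y -> z / (x + y) * (x + y) `^ a <= z `^ a.
  move=> z0 zs; have [->|zN0] := eqVneq z 0; first by rewrite !mul0r powR_ge0.
  have z_gt0 : 0 < z by rewrite lt_neqAle eq_sym zN0.
  rewrite -[in leRHS](divfK sN0 z) powRM ?divr_ge0 ?(ltW s_gt0)//.
  rewrite ler_wpM2r ?powR_ge0// -{1}(powRr1 (divr_ge0 z0 (ltW s_gt0))).
  by rewrite ger_powR// divr_gt0//= ler_pdivrMr// mul1r.
apply: le_trans (lerD (scale x x0 _) (scale y y0 _)); rewrite ?lerDl ?lerDr//.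
by rewrite -mulrDl -mulrDl divff// mul1r.
Qed.

Section Morrey.
Context {R : realType}.
Implicit Types (K : normedZmodType R) (p q a : R).

(** Raising each window bound to the power [p] removes the outer root, so membership becomes a
    growth rate for plain sums, to which telescoping applies. *)
Lemma morreyP K p q (x : int -> K) : 0 < p ->
  morrey K p q x <-> exists C : R, forall m N,
    \sum_(j <- window m N) `|x j| `^ p <= C * (2 * N + 1)%:R `^ (1 - p / q).
Proof.
move=> p0; have pN0 : p != 0 by rewrite gt_eqF.
have T0 m N : 0 <= \sum_(j <- window m N) `|x j| `^ p.
  by apply: sumr_ge0 => j _; exact: powR_ge0.
split.
- move=> xfin; pose A := fine (morrey_norm p q x).
  have term_le m N : (2 * N + 1)%:R `^ (q^-1 - p^-1) *
      (\sum_(j <- window m N) `|x j| `^ p) `^ p^-1 <= A.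
    have ub : (((2 * N + 1)%:R `^ (q^-1 - p^-1) *
      (\sum_(j <- window m N) `|x j| `^ p) `^ p^-1)%:E <= morrey_norm p q x)%E.
      by apply: ereal_sup_ubound; exists (m, N) => //=; rewrite size_window.
    (* [fine] sends infinite values to 0, so finiteness of the norm is what makes [A] an upper
       bound. *)
    rewrite -lee_fin fineK// ge0_fin_numE//.
    by apply: le_trans ub; rewrite lee_fin mulr_ge0// powR_ge0.
  have A0 : 0 <= A by apply: le_trans (term_le 0 0%N);
    rewrite mulr_ge0 ?powR_ge0.
  exists (A `^ p) => m N; set T := \sum_(j <- _) _.
  have S0 : 0 < (2 * N + 1)%:R :> R by rewrite ltr0n addn1.
  have -> : 1 - p / q = (p^-1 - q^-1) * p.
    by rewrite mulrBl mulVf// [_ * p]mulrC.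
  rewrite -[T]powRr1 ?T0// -[X in T `^ X](mulVf pN0) !powRrM -powRM ?powR_ge0//.
  apply: ge0_ler_powR => //.
  + exact: ltW.
  + by rewrite nnegrE powR_ge0.
  + by rewrite nnegrE mulr_ge0 ?powR_ge0.
  + by rewrite -opprB powRN ler_pdivlMr ?powR_gt0// [leLHS]mulrC term_le.
- move=> [C HC]; have C0 : 0 <= C.
    by apply: le_trans (T0 0 0%N) _; have := HC 0 0%N;
    rewrite muln0 powR1 mulr1.
  apply: (@le_lt_trans _ _ (C `^ p^-1)%:E); last exact: ltry.
  apply: ge_ereal_sup => _ [[m N] _ <-] /=; rewrite lee_fin size_window.
  have S0 : 0 < (2 * N + 1)%:R :> R by rewrite ltr0n addn1.
  rewrite -opprB powRN [leLHS]mulrC ler_pdivrMr ?powR_gt0//.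
  have -> : p^-1 - q^-1 = (1 - p / q) / p.
    by rewrite mulrBl mul1r mulrAC mulfV// mul1r.
  rewrite powRrM -powRM ?powR_ge0//; apply: ge0_ler_powR => //.
  + by rewrite invr_ge0 ltW.
  + by rewrite nnegrE T0.
  + by rewrite nnegrE mulr_ge0 ?powR_ge0.
Qed.

(** Clamping at 0 makes the count vanish on nonpositive integers and increase on all of them when
    [a > 0]. *)
Definition sparse_count a (j : int) : nat :=
  Num.truncn ((Num.max 0 j)%:~R `^ a).

(** An element [e] of norm 1 replaces the unit, so that real and complex scalars are treated
    together. The subtraction is in [nat]; for [a > 0] monotonicity keeps it from truncating. *)
Definition sparse_seq K (e : K) a (j : int) : K :=
  e *+ (sparse_count a (j + 1) - sparse_count a j).

Lemma sparse_count_le0 a (j : int) : 0 < a -> j <= 0 -> sparse_count a j = 0%N.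
Proof.
by move=> a0 j0; rewrite /sparse_count max_l// powR0 ?gt_eqF// truncn0.
Qed.

Lemma sparse_count_homo a : 0 < a ->
  {homo sparse_count a : i j / i <= j >-> (i <= j)%N}.
Proof.
move=> a0 i j ij; apply: le_truncn; apply: ge0_ler_powR; first exact: ltW.
- by rewrite nnegrE ler0z le_max lexx.
- by rewrite nnegrE ler0z le_max lexx.
- by rewrite ler_int; lia.
Qed.

(** Subadditivity bounds the power at [j], and truncating the power at [i] loses strictly less than
    1. *)
Lemma sparse_count_lt a (i j : int) : 0 < a -> a <= 1 -> i <= j ->
  (sparse_count a j)%:R < (sparse_count a i)%:R + (j - i)%:~R `^ a + 1 :> R.
Proof.
move=> a0 a1 ij; set u : R := (Num.max 0 i)%:~R.
have u0 : 0 <= u by rewrite ler0z le_max lexx.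
have d0 : 0 <= (j - i)%:~R :> R by rewrite ler0z subr_ge0.
have ub : (sparse_count a j)%:R <= u `^ a + (j - i)%:~R `^ a.
  apply: le_trans (powR_subadditive a0 a1 u0 d0).
  apply: (@le_trans _ _ ((Num.max 0 j)%:~R `^ a)).
    by rewrite truncn_le powR_ge0.
  apply: ge0_ler_powR; rewrite ?nnegrE ?addr_ge0 ?(ltW a0) ?u0
    ?ler0z ?le_max ?lexx ?subr_ge0//.
  by rewrite /u -intrD ler_int; lia.
by apply: le_lt_trans ub _; rewrite addrAC ltrD2r natr1 truncnS_gt.
Qed.

Lemma norm_sparse_seq K (e : K) a p j :
  `|e| = 1 -> 0 < a -> a <= 1 -> 0 < p ->
  `|sparse_seq e a j| `^ p =
    (sparse_count a (j + 1))%:R - (sparse_count a j)%:R.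
Proof.
move=> e1 a0 a1 p0.
have le_c : (sparse_count a j <= sparse_count a (j + 1))%N.
  by apply: sparse_count_homo => //; rewrite lerDl.
(* Strictness matters: between integers it leaves only the increments 0 and 1, which the power [p]
   fixes. *)
have : (sparse_count a (j + 1) < (sparse_count a j).+2)%N.
  rewrite -(ltr_nat R) -addn2 natrD.
  have := @sparse_count_lt a j (j + 1) a0 a1; rewrite lerDl => /(_ isT).
  have -> : j + 1 - j = 1 by lia.
  by rewrite powR1 -addrA.
move=> lt_c; rewrite -natrB// /sparse_seq.
have [->|->] : (sparse_count a (j + 1) - sparse_count a j = 0 \/
  sparse_count a (j + 1) - sparse_count a j = 1)%N by lia.
  by rewrite normr0 powR0 ?gt_eqF.
by rewrite e1 powR1.
Qed.

Lemma sum_sparse_seq K (e : K) a p m N :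
  `|e| = 1 -> 0 < a -> a <= 1 -> 0 < p ->
  \sum_(j <- window m N) `|sparse_seq e a j| `^ p =
    (sparse_count a (m + N%:Z + 1))%:R - (sparse_count a (m - N%:Z))%:R.
Proof.
move=> e1 a0 a1 p0.
rewrite -(sum_window_telescope (fun j => (sparse_count a j)%:R)).
by apply: eq_bigr => j _; exact: norm_sparse_seq.
Qed.

Lemma sparse_seq_morrey K (e : K) p q : `|e| = 1 -> 0 < p -> p < q ->
  morrey K p q (sparse_seq e (1 - p / q)).
Proof.
move=> e1 p0 pq; have q0 : 0 < q by exact: lt_trans pq.
have a0 : 0 < 1 - p / q by rewrite subr_gt0 ltr_pdivrMr ?mul1r.
have a1 : 1 - p / q <= 1 by rewrite gerBl divr_ge0// ltW.
apply/morreyP => //; exists 2 => m N; rewrite sum_sparse_seq//.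
set a := 1 - p / q in a0 a1 *.
have := @sparse_count_lt a (m - N%:Z) (m + N%:Z + 1) a0 a1.
have -> : m - N%:Z <= m + N%:Z + 1 by lia.
have -> : m + N%:Z + 1 - (m - N%:Z) = (2 * N + 1)%:Z by lia.
rewrite -pmulrn => /(_ isT) lt_c.
(* This absorbs the additive 1 in [lt_c], whence the constant 2. *)
have : 1 <= (2 * N + 1)%:R `^ a :> R.
  by rewrite -[leLHS](powRr0 (2 * N + 1)%:R) ler_powR ?(ltW a0)// ler1n addn1.
lra.
Qed.

Lemma sparse_seq_morrey_exponent K (e : K) p q a :
  `|e| = 1 -> 0 < p -> p <= q -> 0 < a -> a <= 1 ->
  morrey K p q (sparse_seq e a) -> a <= 1 - p / q.
Proof.
move=> e1 p0 pq a0 a1 /morreyP -/(_ p0)[C HC]; rewrite leNgt; apply/negP => ga.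
have q0 : 0 < q by exact: lt_le_trans pq.
set g := 1 - p / q in HC ga; have g0 : 0 <= g.
  by rewrite subr_ge0 ler_pdivrMr ?mul1r.
(* The 1 pays for truncation and [2]^ g[for]2 * N + 1 <= 2 * s[. The choice of]N[below makes]s
   [^ (a - g)] exceed [D]. *)
pose D := 1 + `|C| * 2 `^ g.
have D0 : 0 < D by rewrite ltr_pwDl// mulr_ge0 ?powR_ge0.
have d0 : 0 < a - g by rewrite subr_gt0.
pose N := Num.truncn (D `^ (a - g)^-1); pose s : R := N.+1%:R.
have s0 : 0 < s by rewrite ltr0n.
have Dlt : D < s `^ (a - g).
  rewrite -[ltLHS]powRr1 ?(ltW D0)// -[X in D `^ X](mulVf (lt0r_neq0 d0)).
  rewrite powRrM.
  by rewrite gt0_ltr_powR ?nnegrE ?powR_ge0 ?(ltW s0)// truncnS_gt.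
have c_le : (sparse_count a N.+1)%:R <= `|C| * 2 `^ g * s `^ g.
  have := HC 0 N; rewrite sum_sparse_seq//.
  rewrite [sparse_count a (0 - _)]sparse_count_le0//.
  rewrite subr0; have -> : 0 + N%:Z + 1 = N.+1 by lia.
  move=> /le_trans; apply; rewrite -mulrA -powRM ?(ltW s0)//.
  apply: le_trans (ler_wpM2r (powR_ge0 _ _) (ler_norm C)) _.
  apply: ler_wpM2l => //.
  by rewrite ge0_ler_powR ?nnegrE ?mulr_ge0// /s -natrM ler_nat; lia.
have := truncnS_gt (s `^ a); rewrite -[Num.truncn _]/(sparse_count a N.+1).
have sg1 : 1 <= s `^ g.
  by rewrite -[leLHS](powRr0 s) ler_powR// ler1n.
have sD : D * s `^ g < s `^ a.
  have -> : s `^ a = s `^ (a - g) * s `^ g.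
    by rewrite -powRD ?subrK// (gt_eqF s0) implybT.
  by rewrite ltr_pM2r ?powR_gt0.
rewrite -natr1 => lt_c; move: sD; rewrite /D mulrDl mul1r; lra.
Qed.

Lemma morrey_subset_exponent K (e : K) p1 p2 q : `|e| = 1 ->
  0 < p1 -> p1 <= q -> 0 < p2 ->
  morrey K p2 q `<=` morrey K p1 q -> p1 <= p2.
Proof.
move=> e1 p1_gt0 p1q p2_gt0 sub; rewrite leNgt; apply/negP => p21.
(* Assuming [p2 < p1] makes this strict, so the exponent [1 - p2 / q] is positive. *)
have p2q : p2 < q by exact: lt_le_trans p1q.
have q0 : 0 < q by exact: lt_trans p2q.
have := sub _ (sparse_seq_morrey e1 p2_gt0 p2q).
move/sparse_seq_morrey_exponent => /(_ e1 p1_gt0 p1q).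
rewrite subr_gt0 ltr_pdivrMr// mul1r gerBl divr_ge0 ?(ltW q0) ?(ltW p2_gt0)//.
by rewrite lerD2l lerN2 ler_pM2r ?invr_gt0// leNgt p21 => /(_ p2q isT).
Qed.

End Morrey.

Theorem theorem2p1 (R : realType) (p1 p2 q : R)
    (hp1 : 1 <= p1) (hp1q : p1 <= q) (hp2 : 1 <= p2) (hp2q : p2 <= q) :
  (morrey R p2 q `<=` morrey R p1 q -> p1 <= p2) /\
  (morrey (Rcomplex R) p2 q `<=` morrey (Rcomplex R) p1 q -> p1 <= p2).
Proof.
have p1_gt0 : 0 < p1 by exact: lt_le_trans hp1.
have p2_gt0 : 0 < p2 by exact: lt_le_trans hp2.
split; first by apply: (morrey_subset_exponent (e := 1)) => //; exact: normr1.
apply: (morrey_subset_exponent (e := (1 : Rcomplex R))) => //.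
by rewrite /Num.norm /= expr1n expr0n addr0 sqrtr1.
Qed.
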